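(* Let $\mathfrak J$ be a Jacobi-Jordan algebra over a field $\mathbb K$ of characteristic $0$ and let $\pi:\mathfrak J\to \mathrm{End}(M)$ be a representation of $\mathfrak J$ on a vector space $M$. Then for every integer $p\ge 1$ the composition of $\delta^{p-1}:A^{p-1}(\mathfrak J,M)\to L^{p}(\mathfrak J,M)$ and $d^p:L^p(\mathfrak J,M)\to L^{p+1}(\mathfrak J,M)$ vanishes: $d^p\circ\delta^{p-1}=0$.
   Context: A Jacobi-Jordan algebra is a vector space $\mathfrak J$ with a bilinear product $(x,y)\mapsto xy$ such that $xy=yx$ and $x(yz)+y(zx)+z(xy)=0$ for all $x,y,z\in\mathfrak J$. A representation of $\mathfrak J$ on a vector space $M$ is a linear map $\pi:\mathfrak J\to\mathrm{End}(M)$ with $\pi(xy)=-\pi(x)\pi(y)-\pi(y)\pi(x)$ for all $x,y\in\mathfrak J$. For $n\ge1$, $L^n(\mathfrak J,M)$ is the space of $n$-linear maps $\mathfrak J^n\to M$ and $A^n(\mathfrak J,M)$ is its subspace of skew-symmetric maps, i.e. those with $f(x_{\sigma(1)},\dots,x_{\sigma(n)})=\mathrm{sign}(\sigma)f(x_1,\dots,x_n)$ for all permutations $\sigma$; moreover $L^0(\mathfrak J,M)=A^0(\mathfrak J,M)=M$. Define $d^0(m)(x)=\delta^0(m)(x)=\pi(x)m$ for $m\in M$, and for $p\ge1$ define $d^p:L^p(\mathfrak J,M)\to L^{p+1}(\mathfrak J,M)$ and $\delta^p:A^p(\mathfrak J,M)\to L^{p+1}(\mathfrak J,M)$ by $$d^p(c)(x_1,\dots,x_{p+1})=\sum_{i=1}^{p+1}\pi(x_i)c(x_1,\dots,\widehat{x_i},\dots,x_{p+1})+\sum_{1\le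 i<j\le p+1}c(x_ix_j,x_1,\dots,\widehat{x_i},\dots,\widehat{x_j},\dots,x_{p+1}),$$ $$\delta^p(c)(x_1,\dots,x_{p+1})=\sum_{i=1}^{p+1}\pi(x_i)c(x_1,\dots,\widehat{x_i},\dots,x_{p+1})-\sum_{1\le i<j\le p+1}c(x_ix_j,x_1,\dots,\widehat{x_i},\dots,\widehat{x_j},\dots,x_{p+1}),$$ where a hat means the argument is omitted. *)

(* Defs.v *)
From mathcomp Require Import all_boot all_order all_fingroup all_algebra.

Set Implicit Arguments.
Unset Strict Implicit.
Unset Printing Implicit Defensive.

Import GRing.Theory.
Local Open Scope ring_scope.

Record jacobiJordan (K : fieldType) := JacobiJordan {
  jj_sort :> lmodType K;
  jj_mul : {bilinear jj_sort -> jj_sort -> jj_sort};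
  jj_mulC : forall x y, jj_mul x y = jj_mul y x;
  jj_jacobi : forall x y z,
    jj_mul x (jj_mul y z) + jj_mul y (jj_mul z x) + jj_mul z (jj_mul x y) = 0 }.

Arguments jj_mul {K j}.

(* The library puts no module structure on the type of endomorphisms of a
   possibly infinite-dimensional M, so linearity in the algebra is pointwise. *)
Record representation (K : fieldType) (J : jacobiJordan K) (M : lmodType K) :=
  Representation {
  rep :> J -> {linear M -> M};
  rep_linear : forall a x y m, rep (a *: x + y) m = a *: rep x m + rep y m;
  rep_mul : forall x y m,
    rep (jj_mul x y) m = - rep x (rep y m) - rep y (rep x m) }.

Section Cochains.
Variables (K : fieldType) (J M : lmodType K).

Definition upd n (x : {ffun 'I_n -> J}) (k : 'I_n) (u : J) : {ffun 'I_n -> J} :=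
  [ffun l => if l == k then u else x l].

Definition multilinear n (f : {ffun 'I_n -> J} -> M) : Prop :=
  forall (k : 'I_n) (x : {ffun 'I_n -> J}), linear (fun u => f (upd x k u)).

Record multilin n := Multilin {
  multilin_fun :> {ffun 'I_n -> J} -> M;
  multilinP : multilinear multilin_fun }.

Definition skew_symmetric n (f : {ffun 'I_n -> J} -> M) : Prop :=
  forall (s : 'S_n) (x : {ffun 'I_n -> J}),
    f [ffun i => x (s i)] = (-1) ^+ s *: f x.

Record skewlin n := Skewlin {
  skewlin_multilin :> multilin n;
  skewlinP : skew_symmetric skewlin_multilin }.

Definition Lcochain n : Type := if n is 0 then M else multilin n.
Definition Acochain n : Type := if n is 0 then M else skewlin n.

Definition omit n (i : 'I_n.+1) (x : {ffun 'I_n.+1 -> J}) : {ffun 'I_n -> J} :=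
  [ffun k => x (lift i k)].

Definition fcons n (a : J) (x : {ffun 'I_n -> J}) : {ffun 'I_n.+1 -> J} :=
  [ffun k => if unlift ord0 k is Some l then x l else a].

Lemma omit_upd n (i : 'I_n.+1) x u : omit i (upd x i u) = omit i x.
Proof. by apply/ffunP=> k; rewrite !ffunE eq_sym (negbTE (neq_lift i k)). Qed.

Lemma omit_upd_lift n (i : 'I_n.+1) k x u :
  omit i (upd x (lift i k) u) = upd (omit i x) k u.
Proof. by apply/ffunP=> l; rewrite !ffunE (inj_eq (@lift_inj _ i)). Qed.

Lemma fcons_upd n a (x : {ffun 'I_n -> J}) k u :
  fcons a (upd x k u) = upd (fcons a x) (lift ord0 k) u.
Proof.
apply/ffunP=> l; rewrite !ffunE.
case: unliftP => [l' ->|->]; last by rewrite (negbTE (neq_lift _ _)).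
by rewrite !ffunE (inj_eq (@lift_inj _ ord0)).
Qed.

Lemma upd_fcons n a b (x : {ffun 'I_n -> J}) :
  upd (fcons a x) ord0 b = fcons b x.
Proof.
apply/ffunP=> l; rewrite !ffunE.
by case: unliftP => [l' ->|->]; rewrite ?eqxx // eq_sym (negbTE (neq_lift _ _)).
Qed.

Lemma multilinear_sum n (I : finType) (P : pred I)
    (F : I -> {ffun 'I_n -> J} -> M) :
  (forall i, P i -> multilinear (F i)) ->
  multilinear (fun x => \sum_(i | P i) F i x).
Proof.
move=> HF k x a u v; rewrite scaler_sumr -big_split /=.
by apply: eq_bigr => i Pi; apply: HF.
Qed.

Lemma multilinearD n (f g : {ffun 'I_n -> J} -> M) :
  multilinear f -> multilinear g -> multilinear (fun x => f x + g x).
Proof. by move=> Hf Hg k x a u v; rewrite Hf Hg scalerDr addrACA. Qed.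

Lemma multilinearN n (f : {ffun 'I_n -> J} -> M) :
  multilinear f -> multilinear (fun x => - f x).
Proof. by move=> Hf k x a u v; rewrite Hf opprD scalerN. Qed.

End Cochains.

Section Coboundaries.
Variables (K : fieldType) (J : jacobiJordan K) (M : lmodType K).
Variable pi : representation J M.

Definition action_sum n (c : {ffun 'I_n -> J} -> M)
    (x : {ffun 'I_n.+1 -> J}) : M :=
  \sum_(i < n.+1) pi (x i) (c (omit i x)).

(* Once x_j has been removed, x_i still sits at position i because i < j. *)
Definition product_sum n (c : {ffun 'I_n.+1 -> J} -> M)
    (x : {ffun 'I_n.+2 -> J}) : M :=
  \sum_(i < n.+2) \sum_(j < n.+2 | (i < j)%N)
    c (fcons (jj_mul (x i) (x j)) (omit (inord i : 'I_n.+1) (omit j x))).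

Lemma action_sum_multilinear n (c : {ffun 'I_n -> J} -> M) :
  multilinear c -> multilinear (action_sum c).
Proof.
move=> Hc; apply: multilinear_sum => i _ k x a u v.
case: (unliftP i k) => [k' ->|->].
  rewrite !omit_upd_lift Hc linearP !ffunE.
  by rewrite (negbTE (neq_lift i k')).
by rewrite !omit_upd !ffunE eqxx rep_linear.
Qed.

Lemma product_sum_multilinear n (c : {ffun 'I_n.+1 -> J} -> M) :
  multilinear c -> multilinear (product_sum c).
Proof.
move=> Hc; apply: multilinear_sum => i _; apply: multilinear_sum => j lt_ij.
move=> k x a u v.
have lt_in : (i < n.+1)%N by apply: leq_trans lt_ij _; rewrite -ltnS ltn_ord.
have Ei : lift j (inord i : 'I_n.+1) = i.
  by apply: val_inj; rewrite /= inordK // /bump leqNgt lt_ij.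
have neq_ij : (i == j) = false by rewrite -val_eqE /= ltn_eqF.
have lin0 y : linear (fun b => c (fcons b y)).
  move=> e b b'; have := Hc ord0 (fcons 0 y) e b b'.
  by rewrite !upd_fcons.
case: (unliftP j k) => [k' ->|->]; last first.
  rewrite !omit_upd !ffunE eqxx neq_ij -lin0; congr (c (fcons _ _)).
  exact: linearPr.
rewrite !omit_upd_lift.
case: (unliftP (inord i : 'I_n.+1) k') => [l ->|->].
  rewrite !omit_upd_lift !fcons_upd.
  have Ej : (j == lift j (lift (inord i) l)) = false.
    exact: negbTE (neq_lift _ _).
  have E : (i == lift j (lift (inord i) l)) = false.
    rewrite -{1}Ei (inj_eq (@lift_inj _ j)); exact: negbTE (neq_lift _ _).
  by rewrite !ffunE Ej E; apply: Hc.
rewrite !omit_upd Ei !ffunE eqxx eq_sym neq_ij -lin0.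
congr (c (fcons _ _)); exact: linearPl.
Qed.

Lemma d_subproof n (c : multilin J M n.+1) :
  multilinear (fun x => action_sum c x + product_sum c x).
Proof.
by apply: multilinearD; [apply: action_sum_multilinear
  | apply: product_sum_multilinear]; apply: multilinP.
Qed.

Lemma delta_subproof n (c : multilin J M n.+1) :
  multilinear (fun x => action_sum c x - product_sum c x).
Proof.
apply: multilinearD; first by apply: action_sum_multilinear; apply: multilinP.
by apply/multilinearN/product_sum_multilinear/multilinP.
Qed.

Lemma d0_subproof (m : M) :
  multilinear (fun x : {ffun 'I_1 -> J} => pi (x ord0) m).
Proof. by move=> k x a u v; rewrite !ord1 !ffunE eqxx rep_linear. Qed.

Definition d p : Lcochain J M p -> multilin J M p.+1 :=
  match p with
  | 0 => fun m => Multilin (d0_subproof m)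
  | q.+1 => fun c => Multilin (d_subproof c)
  end.

Definition delta p : Acochain J M p -> multilin J M p.+1 :=
  match p with
  | 0 => fun m => Multilin (d0_subproof m)
  | q.+1 => fun c => Multilin (delta_subproof c)
  end.

End Coboundaries.

Arguments d {K J M} pi p c.
Arguments delta {K J M} pi p c.

(* Main.v *)
Require Import Defs.
From mathcomp Require Import all_boot all_order all_fingroup all_algebra.
Import GRing.Theory.
Local Open Scope ring_scope.

Set Implicit Arguments.
Unset Strict Implicit.

(** Write [\sum_(a, r)] for the sum over all ways of extracting one entry [a]
    from a list of arguments, [r] being the list that remains.  Iterating it
    gives a sum over ordered tuples of distinct entries, which is therefore
    invariant under permuting the extracted entries ([pick_sumC]).  In this
    language [d] and [delta] are [A + P] and [A - P], where

      A c = \sum_a pi(a) c(r)    and    2 P c = \sum_a \sum_b c(ab, r),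

    the factor 2 accounting for the two orders of a pair ([pair_sum_double]).
    Up to that factor [d (delta c) = (AA + PA - AP) c - PPc] is computed with
    one more rule: extracting from [u :: r] gives either [u] or an entry of [r].

    - [2 AAc] is [\sum_a \sum_b (pi(a) pi(b) + pi(b) pi(a)) c(r)], which by the
      representation identity is [- \sum_a \sum_b pi(ab) c(r)].
    - [2 PAc] is [\sum_a \sum_b pi(ab) c(r)], which cancels [2 AAc], plus
      [\sum_a \sum_b \sum_e pi(e) c(ab, r)], which is [2 APc].
    - [4 PPc] is a sum of terms [c((ab)e, r)], which cancel cyclically by the
      Jacobi identity, and of terms [c(uv, ab, r)], which change sign when
      the pairs [(a, b)] and [(u, v)] are exchanged, as [c] is skew.

    Lists, rather than functions on ordinals, make the extraction rule a
    structural recursion and remove all index arithmetic; a cochain [c] of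
    degree [n] becomes a function on all lists by giving it the value 0 on
    lists of any other length ([extend]).  Characteristic 0 serves to divide
    by the integers 2, 3 and 4. *)

(** * Sums over extracted entries *)

Section PickSums.
Variables (T : Type) (V : zmodType).
Implicit Types (s r : seq T).

Fixpoint pick_sum (f : T -> seq T -> V) s : V :=
  if s is a :: r then f a r + pick_sum (fun b r' => f b (a :: r')) r else 0.

(** Here each unordered pair of positions is extracted once, the arguments of
    [f] following the order of occurrence: this is a sum over i < j. *)
Fixpoint pair_sum (f : T -> T -> seq T -> V) s : V :=
  if s is a :: r
  then pick_sum (f a) r + pair_sum (fun b e r' => f b e (a :: r')) r else 0.

Lemma eq_pick_sum f g s : f =2 g -> pick_sum f s = pick_sum g s.
Proof.
elim: s f g => //= a s IH f g fg; rewrite fg.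
by congr (_ + _); apply: IH => b r; apply: fg.
Qed.

Lemma pick_sumD f g s :
  pick_sum (fun a r => f a r + g a r) s = pick_sum f s + pick_sum g s.
Proof.
elim: s f g => [|a s IH] f g /=; first by rewrite addr0.
by rewrite (IH (fun b r => f b (a :: r))) addrACA.
Qed.

Lemma pick_sumN f s : pick_sum (fun a r => - f a r) s = - pick_sum f s.
Proof.
elim: s f => [|a s IH] f /=; first by rewrite oppr0.
by rewrite (IH (fun b r => f b (a :: r))) opprD.
Qed.

Lemma pick_sum0 s : pick_sum (fun _ _ => 0) s = 0.
Proof. by elim: s => //= a s ->; rewrite addr0. Qed.

Lemma pick_sumMn f s n :
  pick_sum (fun a r => f a r *+ n) s = pick_sum f s *+ n.
Proof.
elim: s f => [|a s IH] f /=; first by rewrite mul0rn.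
by rewrite (IH (fun b r => f b (a :: r))) mulrnDl.
Qed.

Lemma pair_sumD f g s :
  pair_sum (fun a b r => f a b r + g a b r) s = pair_sum f s + pair_sum g s.
Proof.
elim: s f g => [|a s IH] f g /=; first by rewrite addr0.
by rewrite pick_sumD (IH (fun b e r => f b e (a :: r))) addrACA.
Qed.

Lemma pair_sumN f s : pair_sum (fun a b r => - f a b r) s = - pair_sum f s.
Proof.
elim: s f => [|a s IH] f /=; first by rewrite oppr0.
by rewrite pick_sumN (IH (fun b e r => f b e (a :: r))) opprD.
Qed.

(** Every ordered pair of distinct entries is extracted exactly once, leaving
    the same remainder in either order. *)
Lemma pick_sumC f s :
  pick_sum (fun a => pick_sum (f a)) s =
  pick_sum (fun a => pick_sum (fun b => f b a)) s.
Proof.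
elim: s f => //= e s IH f.
rewrite !pick_sumD (IH (fun a b r => f a b (e :: r))) !addrA.
by rewrite [X in X + _]addrC.
Qed.

Lemma pick_sum_rot f s :
  pick_sum (fun a => pick_sum (fun b => pick_sum (f a b))) s =
  pick_sum (fun a => pick_sum (fun b => pick_sum (fun e => f b e a))) s.
Proof.
rewrite [RHS](pick_sumC (fun a b => pick_sum (fun e => f b e a))).
by apply: eq_pick_sum => a r; apply: pick_sumC.
Qed.

Lemma pick_sum_exchange_pairs (f : T -> T -> T -> T -> seq T -> V) s :
  pick_sum (fun a => pick_sum (fun b =>
    pick_sum (fun u => pick_sum (f a b u)))) s =
  pick_sum (fun a => pick_sum (fun b =>
    pick_sum (fun u => pick_sum (fun v => f u v a b)))) s.
Proof.
(* Moving the first entry to the end, twice. *)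
have rot4 (g : T -> T -> T -> T -> seq T -> V) :
  pick_sum (fun a => pick_sum (fun b =>
    pick_sum (fun u => pick_sum (g a b u)))) s =
  pick_sum (fun a => pick_sum (fun b =>
    pick_sum (fun u => pick_sum (fun v => g v a b u)))) s.
- rewrite -(pick_sum_rot (fun a b e => pick_sum (fun v => g e a b v))).
  apply: eq_pick_sum => a r; apply: eq_pick_sum => b {}r.
  exact: (pick_sumC (fun e v => g e a b v)).
by rewrite rot4 (rot4 (fun a b u v => f v a b u)).
Qed.

Lemma pair_sum_double f s :
  (forall a b r, f a b r = f b a r) ->
  pair_sum f s *+ 2 = pick_sum (fun a => pick_sum (f a)) s.
Proof.
elim: s f => [|a s IH] f fC /=; first by rewrite mul0rn.
rewrite mulrnDl IH; last by move=> b e r; apply: fC.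
by rewrite pick_sumD mulr2n -addrA (@eq_pick_sum (f a) (fun b => f b a)).
Qed.

End PickSums.

Lemma raddf_pick_sum (T : Type) (U V : zmodType) (h : {additive U -> V})
    (f : T -> seq T -> U) s :
  h (pick_sum f s) = pick_sum (fun a r => h (f a r)) s.
Proof.
elim: s f => [|a s IH] f /=; first by rewrite raddf0.
by rewrite raddfD (IH (fun b r => f b (a :: r))).
Qed.

(** * Cochains on lists *)

Section ListCochains.
Variables (K : fieldType) (charK : [pchar K] =i pred0).
Variables (J : jacobiJordan K) (M : lmodType K) (pi : representation J M).
Implicit Types (C : seq J -> M) (s r : seq J).

Local Notation "a ** b" := (jj_mul (j:=J) a b)
  (at level 40, left associativity).

Definition action_list C s : M := pick_sum (fun a r => pi a (C r)) s.

Definition product_list C s : M := pair_sum (fun a b r => C (a ** b :: r)) s.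

Definition head_additive C : Prop :=
  forall a b s, C (a + b :: s) = C (a :: s) + C (b :: s).

Definition head_skew C : Prop :=
  forall a b s, C [:: a, b & s] = - C [:: b, a & s].

Lemma mulrSn_eq0 n (v : M) : v *+ n.+1 = 0 -> v = 0.
Proof.
rewrite -scaler_nat => /eqP; rewrite scaler_eq0.
by have /pcharf0P -> := charK; move=> /= /eqP.
Qed.

Lemma action_listB C C' s :
  action_list (fun r => C r - C' r) s = action_list C s - action_list C' s.
Proof.
rewrite -pick_sumN -pick_sumD.
by apply: eq_pick_sum => a r; rewrite raddfB.
Qed.

Lemma product_listB C C' s :
  product_list (fun r => C r - C' r) s = product_list C s - product_list C' s.
Proof. by rewrite -pair_sumN -pair_sumD. Qed.

Lemma product_list_double C s :
  product_list C s *+ 2 =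
  pick_sum (fun a => pick_sum (fun b r => C (a ** b :: r))) s.
Proof. by apply: pair_sum_double => a b r; rewrite jj_mulC. Qed.

(** The two orders in which two entries can act combine into the action of
    their product. *)
Lemma action_action_list C s :
  action_list (action_list C) s *+ 2 =
  - pick_sum (fun a => pick_sum (fun b r => pi (a ** b) (C r))) s.
Proof.
have actE : action_list (action_list C) s =
    pick_sum (fun a => pick_sum (fun b r => pi a (pi b (C r)))) s.
  by apply: eq_pick_sum => a r; rewrite raddf_pick_sum.
rewrite mulr2n {1}actE pick_sumC actE -pick_sumD -pick_sumN.
apply: eq_pick_sum => a r; rewrite -pick_sumD -pick_sumN.
by apply: eq_pick_sum => b {}r; rewrite rep_mul opprD !opprK addrC.
Qed.

(** The terms of [PA] in which the product itself acts cancel [AA]; in the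
    others the acting entry is extracted after the pair, in [AP] before it. *)
Lemma action_terms_cancel C s :
  action_list (action_list C) s + product_list (action_list C) s
    - action_list (product_list C) s = 0.
Proof.
apply: (@mulrSn_eq0 1); rewrite mulrnBl mulrnDl action_action_list.
rewrite product_list_double -pick_sumMn.
have -> : pick_sum (fun a r => pi a (product_list C r) *+ 2) s =
    pick_sum (fun a => pick_sum (fun b => pick_sum (fun e r =>
      pi e (C (a ** b :: r))))) s.
  rewrite [RHS](pick_sum_rot (fun a b e r => pi e (C (a ** b :: r)))).
  apply: eq_pick_sum => a r; rewrite -raddfMn product_list_double.
  rewrite raddf_pick_sum; apply: eq_pick_sum => b {}r.
  by rewrite raddf_pick_sum.
rewrite -!pick_sumN -!pick_sumD -[RHS](pick_sum0 _ s).
apply: eq_pick_sum => a r; rewrite -!pick_sumN -!pick_sumD.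
rewrite -[RHS](pick_sum0 _ r); apply: eq_pick_sum => b {}r /=.
by rewrite addKr subrr.
Qed.

(** Summing over all orders of three entries repeats each Jacobi relation. *)
Lemma jacobi_terms_cancel C s : head_additive C ->
  pick_sum (fun a => pick_sum (fun b => pick_sum (fun e r =>
    C (a ** (b ** e) :: r)))) s = 0.
Proof.
move=> Cadd; apply: (@mulrSn_eq0 2).
have C0 r : C (0 :: r) = 0.
  by apply: (addrI (C (0 :: r))); rewrite -Cadd !addr0.
pose f a b e r := C (a ** (b ** e) :: r).
have rot1 := pick_sum_rot f s.
have rot2 := etrans rot1 (pick_sum_rot (fun a b e => f b e a) s).
rewrite mulrSr mulr2n {2}rot1 [X in _ + X]rot2.
rewrite -!pick_sumD -[RHS](pick_sum0 _ s).
apply: eq_pick_sum => a r; rewrite -!pick_sumD -[RHS](pick_sum0 _ r).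
apply: eq_pick_sum => b {}r; rewrite -!pick_sumD -[RHS](pick_sum0 _ r).
apply: eq_pick_sum => e {}r; rewrite /f -!Cadd.
by rewrite jj_jacobi C0.
Qed.

(** Exchanging the two extracted pairs turns the sum into its opposite. *)
Lemma skew_terms_cancel C s : head_skew C ->
  pick_sum (fun a => pick_sum (fun b => pick_sum (fun u => pick_sum (fun v r =>
    C [:: u ** v, a ** b & r])))) s = 0.
Proof.
move=> Cskew; apply: (@mulrSn_eq0 1).
rewrite mulr2n {1}pick_sum_exchange_pairs -!pick_sumD -[RHS](pick_sum0 _ s).
apply: eq_pick_sum => a r; rewrite -!pick_sumD -[RHS](pick_sum0 _ r).
apply: eq_pick_sum => b {}r; rewrite -!pick_sumD -[RHS](pick_sum0 _ r).
apply: eq_pick_sum => u {}r; rewrite -!pick_sumD -[RHS](pick_sum0 _ r).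
by apply: eq_pick_sum => v {}r; rewrite Cskew addNr.
Qed.

(** Of two extracted pairs, the second either contains the product of the
    first, in first or second position, or is disjoint from it. *)
Lemma product_product_list C s : head_additive C -> head_skew C ->
  product_list (product_list C) s = 0.
Proof.
move=> Cadd Cskew; apply: (@mulrSn_eq0 3); rewrite (mulrnA _ 2 2).
rewrite product_list_double -pick_sumMn.
transitivity (pick_sum (fun a => pick_sum (fun b => pick_sum (fun e r =>
      C (e ** (a ** b) :: r)))) s *+ 2 +
    pick_sum (fun a => pick_sum (fun b => pick_sum (fun u =>
      pick_sum (fun v r => C [:: u ** v, a ** b & r])))) s).
  rewrite mulr2n -!pick_sumD; apply: eq_pick_sum => a r.
  rewrite -pick_sumMn -!pick_sumD; apply: eq_pick_sum => b {}r.
  rewrite product_list_double /= -addrA pick_sumD; congr (_ + _).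
  by apply: eq_pick_sum => e {}r; rewrite jj_mulC.
rewrite skew_terms_cancel // addr0.
rewrite (pick_sum_rot (fun a b e r => C (e ** (a ** b) :: r))).
by rewrite jacobi_terms_cancel // mul0rn.
Qed.

(** Because of the opposite signs, [(A + P)(A - P)] groups as
    [(AA + PA - AP) - PP], where both parts vanish. *)
Lemma coboundary_list C s : head_additive C -> head_skew C ->
  let B r := action_list C r - product_list C r in
  action_list B s + product_list B s = 0.
Proof.
move=> Cadd Cskew B; rewrite action_listB product_listB.
rewrite product_product_list // subr0 addrAC; exact: action_terms_cancel.
Qed.

End ListCochains.

(** * From functions on ordinals to lists *)

Fixpoint rem_nth (T : Type) i (s : seq T) : seq T :=
  if s is a :: r then (if i is j.+1 then a :: rem_nth j r else r) else [::].

Lemma size_rem_nth T i (s : seq T) :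
  (i < size s)%N -> size (rem_nth i s) = (size s).-1.
Proof.
elim: s i => [|a [|b s] IH] [|i] //= lt_is.
by rewrite IH.
Qed.

Lemma nth_rem_nth T (a0 : T) i s k :
  nth a0 (rem_nth i s) k = nth a0 s (bump i k).
Proof.
elim: s i k => [|a s IH] [|i] [|k] //=; rewrite ?nth_nil //.
by rewrite IH /bump ltnS addnS.
Qed.

Lemma pick_sumE (T : Type) (V : zmodType) (a0 : T) (f : T -> seq T -> V) s :
  pick_sum f s = \sum_(0 <= i < size s) f (nth a0 s i) (rem_nth i s).
Proof.
elim: s f => [|a s IH] f /=; first by rewrite big_nil.
by rewrite big_nat_recl // IH.
Qed.

Lemma pair_sumE (T : Type) (V : zmodType) (a0 : T)
    (f : T -> T -> seq T -> V) s :
  pair_sum f s = \sum_(0 <= i < size s) \sum_(i.+1 <= j < size s)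
    f (nth a0 s i) (nth a0 s j) (rem_nth i (rem_nth j s)).
Proof.
elim: s f => [|a s IH] f /=; first by rewrite big_nil.
rewrite big_nat_recl // IH (pick_sumE a0) big_add1; congr (_ + _).
by apply: eq_bigr => i _; rewrite [RHS]big_add1.
Qed.

Section Translation.
Variables (K : fieldType) (J : jacobiJordan K) (M : lmodType K).
Variable pi : representation J M.

Lemma size_codom_ffun n (x : {ffun 'I_n -> J}) : size (codom x) = n.
Proof. by rewrite size_codom card_ord. Qed.

Lemma nth_codom_ffun n (x : {ffun 'I_n -> J}) (k : 'I_n) :
  nth 0 (codom x) k = x k.
Proof.
by rewrite codomE (nth_map k) ?size_enum_ord // nth_ord_enum.
Qed.

Lemma eq_codom_ffun n (x : {ffun 'I_n -> J}) s :
  size s = n -> (forall k : 'I_n, x k = nth 0 s k) -> codom x = s.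
Proof.
move=> szs xE; apply: (@eq_from_nth _ 0) => [|k].
  by rewrite size_codom_ffun.
rewrite size_codom_ffun => ltkn.
by rewrite -[k]/(nat_of_ord (Ordinal ltkn)) nth_codom_ffun xE.
Qed.

Lemma codom_omit n (i : 'I_n.+1) (x : {ffun 'I_n.+1 -> J}) :
  codom (omit i x) = rem_nth i (codom x).
Proof.
apply: eq_codom_ffun => [|k].
  by rewrite size_rem_nth size_codom_ffun ?ltn_ord.
by rewrite nth_rem_nth ffunE -nth_codom_ffun.
Qed.

Lemma codom_fcons n a (x : {ffun 'I_n -> J}) : codom (fcons a x) = a :: codom x.
Proof.
apply: eq_codom_ffun => [|k]; first by rewrite /= size_codom_ffun.
rewrite ffunE; case: unliftP => [l ->|->] //=.
by rewrite nth_codom_ffun.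
Qed.

Lemma action_sum_codom n (c : {ffun 'I_n -> J} -> M) C x :
  (forall y, c y = C (codom y)) ->
  action_sum pi c x = action_list pi C (codom x).
Proof.
move=> cC; rewrite /action_list (pick_sumE 0) size_codom_ffun big_mkord.
by apply: eq_bigr => i _; rewrite cC codom_omit nth_codom_ffun.
Qed.

Lemma product_sum_codom n (c : {ffun 'I_n.+1 -> J} -> M) C x :
  (forall y, c y = C (codom y)) ->
  product_sum c x = product_list C (codom x).
Proof.
move=> cC; rewrite /product_list (pair_sumE 0) size_codom_ffun big_mkord.
apply: eq_bigr => i _; rewrite big_geq_mkord.
apply: eq_bigr => j lt_ij; rewrite cC codom_fcons !codom_omit !nth_codom_ffun.
by rewrite inordK // (leq_trans lt_ij) // -ltnS ltn_ord.
Qed.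

(** Extending by 0 to lists of the wrong length keeps the cochain additive in
    its first argument and skew in the first two, without length conditions. *)
Definition extend n (c : {ffun 'I_n -> J} -> M) (s : seq J) : M :=
  if size s == n then c [ffun k : 'I_n => nth 0 s k] else 0.

Lemma extend_codom n (c : {ffun 'I_n -> J} -> M) x : c x = extend c (codom x).
Proof.
rewrite /extend size_codom_ffun eqxx; congr c.
by apply/ffunP => k; rewrite ffunE nth_codom_ffun.
Qed.

Lemma extend_additive n (c : multilin J M n.+1) : head_additive (extend c).
Proof.
move=> a b s; rewrite /extend /=; case: ifP => _; last by rewrite addr0.
pose x : {ffun 'I_n.+1 -> J} := [ffun k : 'I_n.+1 => nth 0 (0 :: s) k].
have updE u : [ffun k : 'I_n.+1 => nth 0 (u :: s) k] = upd x ord0 u.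
  by apply/ffunP => k; rewrite !ffunE; case: (unliftP ord0 k) => [l ->|->].
by rewrite !updE; have := multilinP c ord0 x 1 a b; rewrite !scale1r.
Qed.

Lemma extend_skew n (c : skewlin J M n) : head_skew (extend c).
Proof.
move=> a b s; rewrite /extend /=; case: ifP => [/eqP szs|_]; last first.
  by rewrite oppr0.
case: n / szs c => c.
pose t : 'S_(size s).+2 := tperm ord0 (lift ord0 ord0).
have := skewlinP c t [ffun k : 'I_(size s).+2 => nth 0 [:: b, a & s] k].
rewrite odd_tperm neq_lift expr1 scaleN1r => <-; congr (multilin_fun c _).
apply/ffunP => k; rewrite !ffunE permE /=.
case: (unliftP ord0 k) => [l ->|->] //=.
by case: (unliftP ord0 l) => [l' ->|->].
Qed.

End Translation.

Theorem theorem1 (K : fieldType) (charK : [pchar K] =i pred0)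
    (J : jacobiJordan K) (M : lmodType K) (pi : representation J M)
    (p : nat) (c : Acochain J M p) (x : {ffun 'I_p.+2 -> J}) :
  d pi p.+1 (delta pi p c) x = 0.
Proof.
(* In degree 0 the product sum of the extended cochain, concentrated on the
   empty list, is 0, so that delta has the same form in all degrees. *)
have [C [Cadd Cskew deltaE]] : exists C : seq J -> M,
    [/\ head_additive C, head_skew C & forall y,
      delta pi p c y =
      action_list pi C (codom y) - product_list C (codom y)].
  case: p c x => [m|n c] _.
    exists (extend (fun _ : {ffun 'I_0 -> J} => m)); split=> [a b s|a b s|y].
    - by rewrite /extend /= addr0.
    - by rewrite /extend /= oppr0.
    rewrite -(@action_sum_codom _ _ _ _ _ (fun=> m)); last first.
      exact: extend_codom.
    rewrite /action_sum big_ord1 [product_list _ _](_ : _ = 0) ?subr0 //.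
    rewrite /product_list.
    by case: (codom y) (size_codom_ffun y) => [|a [|b s]] //= _; rewrite addr0.
  exists (extend c); split=> [||y].
  - exact: extend_additive.
  - exact: extend_skew.
  rewrite -(@action_sum_codom _ _ _ _ _ c); last exact: extend_codom.
  by rewrite -(@product_sum_codom _ _ _ _ c); last exact: extend_codom.
pose B s := action_list pi C s - product_list C s.
have actE := @action_sum_codom _ _ _ pi _ _ B x deltaE.
have prodE := @product_sum_codom _ _ _ _ _ B x deltaE.
exact: etrans (congr2 +%R actE prodE) (coboundary_list charK _ _ Cadd Cskew).
Qed.
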